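(* Let $d\ge1$. Every $d$-dimensional simplicial polytope with $d+1$, $d+2$ or $d+3$ vertices is combinatorially equivalent to a Veronese polytope.
   Context: A Veronese $d$-polytope is a polytope of the form $\mathrm{conv}\{\nu_d(t)/q_\xi(t):t\in T\}\subset\mathbb R^{d+1}$, where $T\subset\mathbb R$ is finite with $|T|\ge d+1$, $\nu_d(t)=(1,t,\dots,t^d)$, $\xi\in\mathbb R^{d+1}\setminus\{0\}$ and $q_\xi(t)=\sum_{i=0}^d\xi_it^i\ne0$ for $t\in T$ (equivalently, an affine hyperplane section of a pointed full-dimensional cone whose projectivised extremal rays lie on the rational normal curve). A polytope is simplicial if all its facets are simplices. *)

(* Defs.v *)
From mathcomp Require Import all_boot all_order all_algebra finmap.
From mathcomp Require Import boolp classical_sets functions cardinality.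
From mathcomp Require Import reals convex.

Set Implicit Arguments.
Unset Strict Implicit.
Unset Printing Implicit Defensive.

Import Order.TTheory GRing.Theory Num.Theory.

Local Open Scope classical_set_scope.
Local Open Scope ring_scope.

Definition convex_hull (R : realType) (n : nat) (A : set 'rV[R]_n) : set 'rV[R]_n :=
  smallest (@convex_set R 'rV[R]_n) A.

Definition polytope (R : realType) (n : nat) (P : set 'rV[R]_n) : Prop :=
  exists S : {fset 'rV[R]_n}, P = convex_hull [set` S].

Definition affine_hull (R : realType) (n : nat) (A : set 'rV[R]_n) :
    set 'rV[R]_n :=
  [set x | exists (k : nat) (p : 'I_k -> 'rV[R]_n) (c : 'I_k -> R),
     [/\ forall i, A (p i), \sum_(i < k) c i = 1
       & x = \sum_(i < k) c i *: p i]].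

(* The empty set, of dimension -1, has no dimension in this sense. *)
Definition has_dim (R : realType) (n : nat) (A : set 'rV[R]_n) (k : nat) :
    Prop :=
  exists (x0 : 'rV[R]_n) (V : {vspace 'rV[R]_n}),
    \dim V = k /\ affine_hull A = [set x | x - x0 \in V].

Definition affinely_independent (R : realType) (n k : nat)
    (p : 'I_k -> 'rV[R]_n) : Prop :=
  forall c : 'I_k -> R,
    \sum_(i < k) c i = 0 -> \sum_(i < k) c i *: p i = 0 ->
    forall i, c i = 0.

Definition simplex (R : realType) (n : nat) (S : set 'rV[R]_n) : Prop :=
  exists (k : nat) (p : 'I_k.+1 -> 'rV[R]_n),
    affinely_independent p /\ S = convex_hull (range p).

(* The linear form a may be 0: the empty set and P itself are faces. *)
Definition face (R : realType) (n : nat) (P F : set 'rV[R]_n) : Prop :=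
  exists (a : 'cV[R]_n) (b : R),
    (forall x, P x -> (x *m a) 0 0 <= b) /\
    F = [set x | P x /\ (x *m a) 0 0 = b].

Definition vertices (R : realType) (n : nat) (P : set 'rV[R]_n) :
    set 'rV[R]_n :=
  [set v | face P [set v]].

Definition facet (R : realType) (n : nat) (P F : set 'rV[R]_n) : Prop :=
  face P F /\ exists k : nat, has_dim P k.+1 /\ has_dim F k.

Definition simplicial (R : realType) (n : nat) (P : set 'rV[R]_n) : Prop :=
  forall F, facet P F -> simplex F.

(* Isomorphism of face lattices. *)
Definition combinatorially_equivalent (R : realType) (m n : nat)
    (P : set 'rV[R]_m) (Q : set 'rV[R]_n) : Prop :=
  exists phi : set 'rV[R]_m -> set 'rV[R]_n,
    set_bij [set F | face P F] [set G | face Q G] phi /\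
    (forall F F', face P F -> face P F' ->
       (F `<=` F' <-> phi F `<=` phi F')).

Definition nu (R : realType) (d : nat) (t : R) : 'rV[R]_d.+1 :=
  \row_(i < d.+1) t ^+ i.

Definition qxi (R : realType) (d : nat) (xi : 'rV[R]_d.+1) (t : R) : R :=
  \sum_(i < d.+1) xi 0 i * t ^+ i.

(* The generating points need not all be vertices. *)
Definition veronese_polytope (R : realType) (d : nat) (Q : set 'rV[R]_d.+1) :
    Prop :=
  exists (T : {fset R}) (xi : 'rV[R]_d.+1),
    [/\ (d.+1 <= #|` T|)%N, xi != 0,
        forall t, t \in T -> qxi xi t != 0
      & Q = convex_hull [set (qxi xi t)^-1 *: nu d t | t in [set` T]]].

(* Main.v *)
(** Faces of conv(p_1, ..., p_m) correspond to the zero sets of nonnegative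
    vectors in the space of values (f(p_i))_i of affine functions f, that is, to
    complements of supports of nonnegative dependencies of a Gale dual
    g_1, ..., g_m in R^r, with m = d + 1 + r. By Lagrange interpolation, the
    Gale dual of points of the rational normal curve with parameters t_i is,
    up to nonzero factors, (1, t_i, ..., t_i^(r-1)), and the denominators
    q(t_i) realize every sign pattern for which a strictly positive dependency
    exists. So it suffices to find, for r <= 2, nonzero s_i and distinct t_i
    such that s_i (1, ..., t_i^(r-1)) has the same supports of nonnegative
    dependencies as g_i. Simpliciality says that such supports have more than r
    elements. For r = 2, no g_i vanishes and no two are opposite; after a linear
    change of coordinates g_i = rho_i (1, tau_i), and the supports only depend
    on the order of tau_i and tau_j for rho_i, rho_j of opposite signs, so equal
    tau's, which have equal signs, can be separated. *)

Require Import Defs.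
From mathcomp Require Import all_boot all_order all_algebra finmap.
From mathcomp Require Import boolp classical_sets functions cardinality.
From mathcomp Require Import reals convex.
From mathcomp Require Import interval_inference ring lra zify.

Set Implicit Arguments.
Unset Strict Implicit.
Unset Printing Implicit Defensive.

Import Order.TTheory GRing.Theory Num.Theory.

Local Open Scope classical_set_scope.
Local Open Scope card_scope.
Local Open Scope ring_scope.

(** * Linear forms and Farkas' lemma *)

Local Notation dot x a := ((x *m a) 0 0).

Lemma dotZl (R : pzRingType) n k (x : 'rV[R]_n) (a : 'cV[R]_n) :
  dot (k *: x) a = k * dot x a.
Proof. by rewrite -scalemxAl mxE. Qed.

Lemma dotBl (R : pzRingType) n (x y : 'rV[R]_n) (a : 'cV[R]_n) :
  dot (x - y) a = dot x a - dot y a.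
Proof. by rewrite mulmxBl !mxE. Qed.

Lemma dotBr (R : pzRingType) n (x : 'rV[R]_n) (a b : 'cV[R]_n) :
  dot x (a - b) = dot x a - dot x b.
Proof. by rewrite mulmxBr !mxE. Qed.

Lemma dotNr (R : pzRingType) n (x : 'rV[R]_n) (a : 'cV[R]_n) :
  dot x (- a) = - dot x a.
Proof. by rewrite mulmxN mxE. Qed.

Lemma dotZr (R : comPzRingType) n k (x : 'rV[R]_n) (a : 'cV[R]_n) :
  dot x (k *: a) = k * dot x a.
Proof. by rewrite -scalemxAr mxE. Qed.

Lemma dot_suml (R : pzRingType) n m (x : 'I_m -> 'rV[R]_n) (a : 'cV[R]_n) :
  dot (\sum_i x i) a = \sum_i dot (x i) a.
Proof. by rewrite mulmx_suml summxE. Qed.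

Lemma dot_comb (R : pzRingType) n m (c : 'I_m -> R) (p : 'I_m -> 'rV[R]_n)
    (a : 'cV[R]_n) :
  dot (\sum_i c i *: p i) a = \sum_i c i * dot (p i) a.
Proof. by rewrite dot_suml; apply: eq_bigr => i _; rewrite dotZl. Qed.

Lemma dot_sqr_gt0 (R : realFieldType) n (x : 'rV[R]_n) :
  x != 0 -> 0 < dot x x^T.
Proof.
move=> x0; have xx i : 0 <= x 0 i * x^T i 0 by rewrite mxE -expr2 sqr_ge0.
rewrite mxE lt0r sumr_ge0 // andbT; apply: contra x0.
rewrite psumr_eq0 // => /allP h; apply/eqP/rowP => i.
by have := h i (mem_index_enum _); rewrite !mxE -expr2 sqrf_eq0 => /eqP.
Qed.

(* If the functional y given by induction is positive on the first generator,
   project along that generator and use the induction hypothesis again. *)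
Lemma farkas (R : realFieldType) n m (a : 'I_m -> 'rV[R]_n) (b : 'rV[R]_n) :
  (exists2 x : 'I_m -> R, (forall i, 0 <= x i) & b = \sum_i x i *: a i) \/
  (exists2 y : 'cV[R]_n, (forall i, dot (a i) y <= 0) & 0 < dot b y).
Proof.
elim: m a b => [|m IH] a b.
  have [->|b0] := eqVneq b 0.
    by left; exists (fun=> 0) => //; rewrite big_ord0.
  by right; exists b^T => [[]//|]; exact: dot_sqr_gt0.
set a0 := a ord0; set a' := fun i => a (lift ord0 i).
have ext (x0 : R) (x : 'I_m -> R) : 0 <= x0 -> (forall i, 0 <= x i) ->
    b = x0 *: a0 + \sum_i x i *: a' i ->
    exists2 x : 'I_m.+1 -> R, (forall i, 0 <= x i) & b = \sum_i x i *: a i.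
  move=> x00 xge ->; exists (fun i => oapp x x0 (unlift ord0 i)).
    by move=> i; case: (unlift ord0 i).
  rewrite big_ord_recl unlift_none; congr (_ + _).
  by apply: eq_bigr => i _; rewrite liftK.
case: (IH a' b) => [[x xge bE]|[y ya yb]].
  by left; apply: (ext 0 x) => //; rewrite scale0r add0r.
have [a0y|a0y] := leP (dot a0 y) 0.
  by right; exists y => // i; case: (unliftP ord0 i) => [j|] ->; [exact: ya|].
pose k := dot a0 y.
(* These vectors are [k] times the projections along [a0] onto the kernel of [y]. *)
case: (IH (fun i => k *: a' i - dot (a' i) y *: a0) (k *: b - dot b y *: a0)).
- move=> [x xge bE]; left.
  pose s := \sum_i x i * dot (a' i) y.
  have s0 : s <= 0 by apply: sumr_le0 => i _; rewrite mulr_ge0_le0.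
  apply: (ext ((dot b y - s) / k) x) => //.
    by rewrite divr_ge0 ?ltW // subr_gt0 (le_lt_trans s0).
  have k0 : k != 0 by rewrite gt_eqF.
  apply: (scalerI k0); rewrite scalerDr scalerA mulrCA divff // mulr1.
  have -> : k *: b = dot b y *: a0 +
      \sum_i x i *: (k *: a' i - dot (a' i) y *: a0).
    by rewrite -bE addrC subrK.
  have -> : \sum_i x i *: (k *: a' i - dot (a' i) y *: a0) =
      \sum_i (k *: (x i *: a' i) - (x i * dot (a' i) y) *: a0).
    by apply: eq_bigr => i _; rewrite scalerBr !scalerA (mulrC (x i) k).
  by rewrite sumrB -scaler_sumr -scaler_suml scalerBl addrA addrAC.
- move=> [z za zb]; right; exists (k *: z - dot a0 z *: y) => [i|].
    case: (unliftP ord0 i) => [j|] ->; rewrite dotBr !dotZr.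
      by have := za j; rewrite dotBl !dotZl (mulrC (dot (a' j) y)).
    by rewrite -/a0 -/k mulrC subrr.
  by move: zb; rewrite dotBr !dotZr dotBl !dotZl (mulrC (dot b y)).
Qed.

(** * Convex hulls of finite families and their faces *)

Lemma convex_set_comb (R : realType) n (A : set 'rV[R]_n) m
    (p : 'I_m -> 'rV[R]_n) (c : 'I_m -> R) :
  convex_set A -> (forall i, c i != 0 -> A (p i)) -> (forall i, 0 <= c i) ->
  \sum_i c i = 1 -> A (\sum_i c i *: p i).
Proof.
move=> cA; elim: m p c => [|m IH] p c Ap c0.
  by rewrite big_ord0 => /esym/eqP; rewrite oner_eq0.
rewrite !big_ord_recl => c1.
have cs : \sum_(i < m) c (lift ord0 i) = 1 - c ord0.
  by rewrite -c1 addrC addKr.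
have le1 : c ord0 <= 1 by rewrite -subr_ge0 -cs sumr_ge0.
have [z0|nz] := eqVneq (c ord0) 0.
  rewrite z0 scale0r add0r; apply: IH => // [i /Ap //|].
  by rewrite cs z0 subr0.
have [e1|ne1] := eqVneq (c ord0) 1.
  rewrite e1 scale1r big1 ?addr0 => [|i _]; first exact: Ap.
  move: cs; rewrite e1 subrr => /eqP; rewrite psumr_eq0 // => /allP/(_ i).
  by rewrite mem_index_enum => /(_ isT) /eqP ->; rewrite scale0r.
have n0 : 1 - c ord0 != 0 by rewrite subr_eq0 eq_sym.
have l01 : Itv.spec (@Itv.num_sem R) (Itv.Real `[0%Z, 1%Z]) (c ord0).
  by rewrite /Itv.spec/= /Itv.num_sem/= num_real/= in_itv/= c0 le1.
pose l : {i01 R} := Itv.mk l01.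
have -> : \sum_(i < m) c (lift ord0 i) *: p (lift ord0 i) =
    (1 - c ord0) *:
      (\sum_(i < m) (c (lift ord0 i) / (1 - c ord0)) *: p (lift ord0 i)).
  rewrite scaler_sumr; apply: eq_bigr => i _.
  by rewrite scalerA mulrCA divff // mulr1.
set q := \sum_i _; have Aq : A q.
  apply: IH => [i|i|]; last by rewrite -mulr_suml cs divff.
    by rewrite mulf_eq0 negb_or => /andP[/Ap].
  by rewrite divr_ge0 // subr_ge0.
exact: set_mem (cA (p ord0) q l (mem_set (Ap ord0 nz)) (mem_set Aq)).
Qed.

Lemma convex_set_hull (R : realType) n (A : set 'rV[R]_n) :
  convex_set (convex_hull A).
Proof.
move=> x y l /set_mem hx /set_mem hy; apply: mem_set => B [cB AB].
by apply/set_mem/cB; apply: mem_set; [exact: hx | exact: hy].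
Qed.

Lemma convex_hullS (R : realType) n (A B : set 'rV[R]_n) :
  A `<=` B -> convex_hull A `<=` convex_hull B.
Proof. by apply: sub_smallest2r; exact: convex_set_hull. Qed.

Lemma convex_hull_imageP (R : realType) n m (p : 'I_m -> 'rV[R]_n)
    (I : set 'I_m) x :
  convex_hull (p @` I) x <-> exists c : 'I_m -> R,
    [/\ forall i, 0 <= c i, forall i, c i != 0 -> I i, \sum_i c i = 1
      & x = \sum_i c i *: p i].
Proof.
split=> [hx|[c [c0 cI c1 ->]]]; last first.
  move=> A [cA pA]; apply: convex_set_comb => // i ci0.
  by apply: pA; exists i => //; apply: cI.
suff : [set x | exists c : 'I_m -> R,
    [/\ forall i, 0 <= c i, forall i, c i != 0 -> I i, \sum_i c i = 1
      & x = \sum_i c i *: p i]] x by [].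
apply: hx; split.
  move=> _ _ l /set_mem[c [c0 cI c1 ->]] /set_mem[c' [c0' cI' c1' ->]].
  apply: mem_set; exists (fun i => l%:num * c i + (1 - l%:num) * c' i); split.
  - by move=> i; rewrite addr_ge0 // mulr_ge0 // subr_ge0.
  - move=> i; have [ci|/cI //] := eqVneq (c i) 0.
    have [ci'|/cI' //] := eqVneq (c' i) 0.
    by rewrite ci ci' !mulr0 addr0 eqxx.
  - by rewrite big_split/= -!mulr_sumr c1 c1'; ring.
  - rewrite /conv/= !scaler_sumr -big_split/=; apply: eq_bigr => i _.
    by rewrite !scalerA -scalerDl.
move=> _ [i Ii <-]; exists (fun j => (j == i)%:R); split=> [j|j||].
- by rewrite ler0n.
- by have [->|] := eqVneq j i; rewrite ?eqxx.
- by rewrite (bigD1 i)//= eqxx big1 ?addr0 // => j /negbTE ->.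
- rewrite (bigD1 i)//= eqxx scale1r big1 ?addr0 // => j /negbTE ->.
  by rewrite scale0r.
Qed.

Lemma convex_hull_le (R : realType) n m (p : 'I_m -> 'rV[R]_n)
    (a : 'cV[R]_n) (b : R) :
  (forall i, dot (p i) a <= b) ->
  forall x, convex_hull (range p) x -> dot x a <= b.
Proof.
move=> pb x /convex_hull_imageP[c [c0 _ c1 ->]].
rewrite dot_comb -[b]mul1r -c1 mulr_suml.
by apply: ler_sum => i _; rewrite ler_wpM2l.
Qed.

(** Faces are recorded by the indices of the generators they contain, which lets polytopes in
    different spaces be compared. *)
Definition face_support (R : realType) n m (p : 'I_m -> 'rV[R]_n)
    (I : set 'I_m) : Prop :=
  exists (a : 'cV[R]_n) (b : R),
    (forall i, dot (p i) a <= b) /\ I = [set i | dot (p i) a = b].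

(** A convex combination attains the bound [b] only if the nonnegative terms
    [c i * (b - dot (p i) a)], whose sum is then zero, all vanish; so its weights lie on the
    hyperplane. *)
Lemma hull_supporting_section (R : realType) n m (p : 'I_m -> 'rV[R]_n)
    (a : 'cV[R]_n) (b : R) :
  (forall i, dot (p i) a <= b) ->
  [set x | convex_hull (range p) x /\ dot x a = b] =
  convex_hull (p @` [set i | dot (p i) a = b]).
Proof.
move=> pb; apply/seteqP; split=> x /=.
  move=> [/convex_hull_imageP[c [c0 _ c1 xE]] xb].
  apply/convex_hull_imageP; exists c; split=> // i ci /=.
  have : \sum_i c i * (b - dot (p i) a) = 0.
    under eq_bigr do rewrite mulrBr.
    by rewrite sumrB -mulr_suml c1 mul1r -dot_comb -xE xb subrr.
  move/eqP; rewrite psumr_eq0 => [|j _]; last by rewrite mulr_ge0 ?subr_ge0.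
  move=> /allP/(_ i); rewrite mem_index_enum => /(_ isT).
  by rewrite mulf_eq0 (negbTE ci)/= subr_eq0 => /eqP.
move=> /convex_hull_imageP[c [c0 cI c1 xE]]; split.
  by apply/convex_hull_imageP; exists c; split.
rewrite xE dot_comb -[RHS]mul1r -c1 mulr_suml; apply: eq_bigr => i _.
by have [->|/cI ->//] := eqVneq (c i) 0; rewrite !mul0r.
Qed.

Lemma face_hullP (R : realType) n m (p : 'I_m -> 'rV[R]_n) F :
  face (convex_hull (range p)) F <->
  exists2 I, face_support p I & F = convex_hull (p @` I).
Proof.
split=> [[a [b [Pb ->]]]|[I [a [b [pb ->]]] ->]]; last first.
  exists a, b; split; first exact: convex_hull_le.
  by rewrite hull_supporting_section.
have pb i : dot (p i) a <= b by apply: Pb; apply: sub_gen_smallest; exists i.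
by rewrite hull_supporting_section //; eexists; first by exists a, b.
Qed.

Lemma face_support_mem (R : realType) n m (p : 'I_m -> 'rV[R]_n) I i :
  face_support p I -> convex_hull (p @` I) (p i) <-> I i.
Proof.
move=> [a [b [pb ->]]]; rewrite -hull_supporting_section //.
by split=> [[]//|?]; split=> //; apply: sub_gen_smallest; exists i.
Qed.

Lemma face_support_trace (R : realType) n m (p : 'I_m -> 'rV[R]_n) I :
  face_support p I -> [set i | convex_hull (p @` I) (p i)] = I.
Proof.
by move=> pI; apply/seteqP; split=> i /=; apply: (face_support_mem i pI).1
  || apply: (face_support_mem i pI).2.
Qed.

Lemma face_support_sub (R : realType) n m (p : 'I_m -> 'rV[R]_n) I I' :
  face_support p I -> face_support p I' ->
  (convex_hull (p @` I) `<=` convex_hull (p @` I')) <-> I `<=` I'.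
Proof.
move=> pI pI'; split=> [h i|h].
  by move/(face_support_mem i pI).2 => /h /(face_support_mem i pI').1.
move=> x /convex_hull_imageP[c [c0 cI c1 xE]].
by apply/convex_hull_imageP; exists c; split=> // i /cI /h.
Qed.

(** A face is recovered from the indices of the generators in it, and inclusion of faces is
    inclusion of these index sets; this holds for any generators, vertices or not. *)
Lemma face_support_equivalent (R : realType) n n' m (p : 'I_m -> 'rV[R]_n)
    (q : 'I_m -> 'rV[R]_n') :
  (forall I, face_support p I <-> face_support q I) ->
  combinatorially_equivalent (convex_hull (range p)) (convex_hull (range q)).
Proof.
move=> pq; exists (fun F => convex_hull (q @` [set i | F (p i)])).
split; first split.
- move=> F /= /face_hullP[I pI ->]; rewrite face_support_trace //.
  by apply/face_hullP; exists I => //; apply/pq.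
- move=> F F' /set_mem/face_hullP[I pI ->] /set_mem/face_hullP[I' pI' ->].
  rewrite !face_support_trace // => qII'.
  suff -> : I = I' by [].
  have qI := (pq I).1 pI; have qI' := (pq I').1 pI'.
  by rewrite -(face_support_trace qI) qII' face_support_trace.
- move=> G /= /face_hullP[I qI ->]; have pI := (pq I).2 qI.
  exists (convex_hull (p @` I)); last by rewrite face_support_trace.
  by apply/face_hullP; exists I.
move=> _ _ /face_hullP[I pI ->] /face_hullP[I' pI' ->].
rewrite !face_support_trace //.
have qI := (pq I).1 pI; have qI' := (pq I').1 pI'.
by rewrite (face_support_sub pI pI') (face_support_sub qI qI').
Qed.

(** * Homogenization, vertices and dimension *)

Definition homog (R : pzRingType) n (x : 'rV[R]_n) : 'rV[R]_(1 + n) :=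
  row_mx 1%:M x.

Definition homog_mx (R : pzRingType) n m (p : 'I_m -> 'rV[R]_n) :
    'M[R]_(m, 1 + n) := \matrix_i homog (p i).

Lemma homog_comb (R : comPzRingType) n m (c : 'I_m -> R) (p : 'I_m -> 'rV[R]_n) :
  \sum_i c i *: homog (p i) = row_mx (\sum_i c i)%:M (\sum_i c i *: p i).
Proof.
transitivity (\sum_i row_mx (c i)%:M (c i *: p i)).
  by apply: eq_bigr => i _; rewrite scale_row_mx scale_scalar_mx mulr1.
elim/big_ind3 : _ => [|x1 x2 x3 y1 y2 y3 -> ->|//]; first by rewrite raddf0 row_mx0.
by rewrite add_row_mx raddfD.
Qed.

Lemma dot_homog (R : pzRingType) n (x : 'rV[R]_n) (y : 'cV[R]_(1 + n)) :
  dot (homog x) y = y 0 0 + dot x (dsubmx y).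
Proof.
rewrite -[y in LHS]vsubmxK mul_row_col mul1mx mxE; congr (_ + _).
by rewrite mxE; congr (y _ _); apply: val_inj.
Qed.

Lemma homog_combP (R : comNzRingType) n m (p : 'I_m -> 'rV[R]_n) x (c : 'I_m -> R) :
  homog x = \sum_i c i *: homog (p i) <->
  \sum_i c i = 1 /\ x = \sum_i c i *: p i.
Proof.
rewrite homog_comb; split=> [/eq_row_mx[/matrixP/(_ 0 0)]|[-> ->]//].
by rewrite !mxE eqxx !mulr1n => <- ->.
Qed.

(** Induction discards generators in the hull of the others. In an irredundant family, Farkas' lemma
    for the homogenized points gives an affine function positive at one generator and nonpositive at
    the others, which exposes it as a vertex. *)
Lemma polytope_vertices (R : realType) n (P : set 'rV[R]_n) :
  polytope P -> exists m (p : 'I_m -> 'rV[R]_n),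
    [/\ injective p, P = convex_hull (range p)
      & forall i, vertices P (p i)].
Proof.
move=> [S PS].
have [m [p {S PS}]] : exists m (p : 'I_m -> 'rV[R]_n),
    P = convex_hull (range p).
  exists (size (enum_fset S)), (tnth (in_tuple (enum_fset S))).
  rewrite PS; congr convex_hull; apply/seteqP; split=> x /=.
    by move=> xS; have /tnthP[i ->] : x \in in_tuple (enum_fset S) by [];
      exists i.
  by move=> [i _ <-]; exact: mem_tnth.
elim: m p => [|m IH] p PE; first by exists 0%N, p; split=> // -[].
pose others i := convex_hull (range (p \o lift i)).
have [[i pi]|/forallNP indep] := pselect (exists i, others i (p i)).
  apply: (IH (p \o lift i)); rewrite PE; apply/seteqP; split.
    apply: smallest_sub => [|_ [j _ <-]]; first exact: convex_set_hull.
    by case: (unliftP i j) => [k ->|-> //]; apply: sub_gen_smallest; exists k.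
  by apply: convex_hullS => _ [k _ <-]; exists (lift i k).
exists m.+1, p; split=> // [i j pij|i].
  apply/eqP/negP => /negP ij; apply: (indep i); rewrite pij.
  have [k ->|jj] := unliftP i j; last by rewrite jj eqxx in ij.
  by apply: sub_gen_smallest; exists k.
have [[c c0 /homog_combP[c1 pE]]|[y yp yi]] :=
    farkas (fun k => homog (p (lift i k))) (homog (p i)).
  by case: (indep i); apply/convex_hull_imageP; exists c; split.
rewrite /vertices /= PE; apply/face_hullP; exists [set i]; last first.
  rewrite image_set1 /convex_hull smallest_id // => x x' l.
  move=> /set_mem/= -> /set_mem/= ->; apply: mem_set => /=.
  by rewrite convmm.
exists (dsubmx y), (dot (p i) (dsubmx y)).
move: yi; rewrite dot_homog => yi.
have lt k : dot (p (lift i k)) (dsubmx y) < dot (p i) (dsubmx y).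
  by have := yp k; rewrite dot_homog => yk; lra.
split=> [j|].
  by case: (unliftP i j) => [k|] ->; rewrite // ltW.
apply/seteqP; split=> [j ->//|j] /=.
by case: (unliftP i j) => [k|] -> // e; have := lt k; rewrite e ltxx.
Qed.

Lemma mem_homog_hull (R : realType) n m (p : 'I_m -> 'rV[R]_n) x :
  convex_hull (range p) x -> (homog x <= homog_mx p)%MS.
Proof.
move=> /convex_hull_imageP[c [c0 _ c1 xE]].
rewrite (homog_combP p x c).2 //; apply: summx_sub => i _.
by apply: scalemx_sub; rewrite -(rowK (fun i => homog (p i)) i) row_sub.
Qed.

Lemma sub_homog_mxP (R : realType) n m (p : 'I_m -> 'rV[R]_n) x :
  reflect (exists c : 'I_m -> R,
             \sum_i c i = 1 /\ x = \sum_i c i *: p i)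
          (homog x <= homog_mx p)%MS.
Proof.
apply: (iffP submxP) => [[D DE]|[c /homog_combP cE]].
  exists (D 0); apply/homog_combP; rewrite DE mulmx_sum_row.
  by apply: eq_bigr => i _; rewrite rowK.
exists (\row_i c i); rewrite mulmx_sum_row cE; apply: eq_bigr => i _.
by rewrite rowK mxE.
Qed.

Lemma affine_hull_convex_hull (R : realType) n m (p : 'I_m -> 'rV[R]_n) :
  affine_hull (convex_hull (range p)) = [set x | (homog x <= homog_mx p)%MS].
Proof.
apply/seteqP; split=> x /=.
  move=> [k [q [c [hq c1 xE]]]]; rewrite (homog_combP q x c).2 //.
  by apply: summx_sub => i _; apply: scalemx_sub; apply: mem_homog_hull.
move=> /sub_homog_mxP[c [c1 xE]]; exists m, p, c; split=> // i.
by apply: sub_gen_smallest; exists i.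
Qed.

Lemma vspace_rows (R : fieldType) n (V : {vspace 'rV[R]_n}) :
  exists2 B : 'M[R]_(\dim V, n), row_free B &
    forall x, (x \in V) = (x <= B)%MS.
Proof.
have bV := vbasisP V; have fV := basis_free bV.
exists (\matrix_i (vbasis V)`_i).
  rewrite -kermx_eq0; apply/rowV0P => u /sub_kermxP; rewrite mulmx_sum_row.
  under eq_bigr do rewrite rowK.
  by move/freeP: fV => /[apply] u0; apply/rowP => i; rewrite u0 mxE.
move=> x; apply/idP/submxP => [xV|[D ->]].
  exists (\row_i coord (vbasis V) i x); rewrite mulmx_sum_row.
  rewrite {1}(coord_vbasis xV); apply: eq_bigr => i _.
  by rewrite rowK mxE.
rewrite mulmx_sum_row; apply: memv_suml => i _; rewrite rowK; apply: memvZ.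
by apply: vbasis_mem; rewrite mem_nth // size_tuple.
Qed.

Lemma row_free_vspace (R : fieldType) n k (B : 'M[R]_(k, n)) :
  row_free B -> exists2 V : {vspace 'rV[R]_n}, \dim V = k &
    forall x, (x \in V) = (x <= B)%MS.
Proof.
move=> fB; pose X := [tuple row i B | i < k].
have XE (i : 'I_k) : X`_i = row i B by rewrite -tnth_nth tnth_mktuple.
exists <<X>>%VS.
  have /eqP -> : free X; last exact: size_tuple.
  apply/freeP => c; under eq_bigr do rewrite XE.
  move=> c0 i; have : \row_i c i *m B == 0.
    apply/eqP; rewrite mulmx_sum_row; apply: etrans c0.
    by apply: eq_bigr => j _; rewrite mxE.
  by rewrite mulmx_free_eq0 // => /eqP/rowP/(_ i); rewrite !mxE.
move=> x; apply/idP/submxP => [/coord_span ->|[D ->]].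
  exists (\row_i coord X i x); rewrite mulmx_sum_row; apply: eq_bigr => i _.
  by rewrite mxE XE.
rewrite mulmx_sum_row; apply: memv_suml => i _; apply: memvZ.
by rewrite -XE; apply: memv_span; rewrite mem_nth // size_tuple.
Qed.

(** The homogenized points have the same row space as [homog x0] together with the rows of [B]
    preceded by a zero, and these are independent. *)
Lemma mxrank_homog (R : realType) n m (p : 'I_m -> 'rV[R]_n) x0 k
    (B : 'M[R]_(k, n)) :
  row_free B ->
  (forall x, (homog x <= homog_mx p)%MS = (x - x0 <= B)%MS) ->
  \rank (homog_mx p) = k.+1.
Proof.
move=> fB pB; pose N := col_mx (homog x0) (row_mx 0 B).
have fN : row_free N.
  rewrite -kermx_eq0; apply/rowV0P => u /sub_kermxP.
  rewrite -[u]hsubmxK mul_row_col mul_mx_row mul_mx_row mulmx0 mulmx1.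
  rewrite add_row_mx addr0 -row_mx0 => /eq_row_mx[-> ].
  by rewrite mul0mx add0r => /eqP; rewrite mulmx_free_eq0 // => /eqP ->;
    rewrite row_mx0.
rewrite -[RHS](eqP fN); apply/eqmx_rank/andP; split.
  apply/row_subP => i; rewrite rowK.
  have : (p i - x0 <= B)%MS by rewrite -pB -(rowK (fun i => homog (p i)) i) row_sub.
  move=> /submxP[D pE]; apply/submxP; exists (row_mx 1%:M D).
  rewrite mul_row_col mul_mx_row mul_mx_row mulmx0 !mul1mx add_row_mx.
  by rewrite addr0 -pE addrC subrK.
have x0p : (homog x0 <= homog_mx p)%MS by rewrite pB subrr sub0mx.
rewrite col_mx_sub x0p/=; apply/row_subP => i.
have -> : row i (row_mx 0 B) = homog (x0 + row i B) - homog x0.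
  by rewrite row_row_mx row0 opp_row_mx add_row_mx subrr addrAC subrr add0r.
by apply: addmx_sub; rewrite ?eqmx_opp // pB addrAC subrr add0r row_sub.
Qed.

(** Turns dimension into a matrix rank; the shift by one comes from the homogenizing coordinate. *)
Lemma has_dim_convex_hull (R : realType) n m (p : 'I_m -> 'rV[R]_n) k :
  has_dim (convex_hull (range p)) k <-> \rank (homog_mx p) = k.+1.
Proof.
rewrite /has_dim affine_hull_convex_hull; split=> [[x0 [V [<- pV]]]|rk].
  have [B fB VB] := vspace_rows V; apply: (mxrank_homog (x0 := x0) fB) => x.
  by rewrite -VB; apply/idP/idP; move/seteqP: pV => [h1 h2];
    [exact: h1 | exact: h2].
have i0 : 'I_m.
  by case: m p rk => [p|m p _]; [rewrite flatmx0 mxrank0 | exact: ord0].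
pose C := \matrix_i (p i - p i0).
have CE x : (homog x <= homog_mx p)%MS = (x - p i0 <= row_base C)%MS.
  rewrite eq_row_base; apply/sub_homog_mxP/submxP => [[c [c1 ->]]|[D xE]].
    exists (\row_i c i); rewrite mulmx_sum_row.
    under [RHS]eq_bigr do rewrite rowK mxE scalerBr.
    by rewrite sumrB -scaler_suml c1 scale1r.
  (* A combination of differences becomes an affine one by correcting the coefficient at [i0] so
     that the total is one. *)
  exists (fun i => D 0 i + (1 - \sum_j D 0 j) * (i == i0)%:R).
  have si : \sum_i (i == i0)%:R = 1 :> R.
    by rewrite (bigD1 i0)//= eqxx big1 ?addr0 // => j /negbTE ->.
  split; first by rewrite big_split/= -mulr_sumr si mulr1 addrC subrK.
  rewrite -[x](subrK (p i0)) xE mulmx_sum_row.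
  under eq_bigr do rewrite rowK scalerBr.
  under [RHS]eq_bigr do rewrite scalerDl.
  rewrite sumrB [RHS]big_split/= -scaler_suml.
  have -> : \sum_i ((1 - \sum_j D 0 j) * (i == i0)%:R) *: p i =
      (1 - \sum_j D 0 j) *: p i0.
    move: (1 - _) => s; rewrite (bigD1 i0)//= eqxx mulr1 big1 ?addr0 //.
    by move=> j /negbTE ->; rewrite mulr0 scale0r.
  by rewrite scalerBl scale1r -addrA [- _ + _]addrC.
have fC : row_free (row_base C) by exact: row_base_free.
have rC := mxrank_homog fC CE.
have [V dV VE] := row_free_vspace fC.
exists (p i0), V; split; first by rewrite dV; move: rC; rewrite rk => -[].
by apply/seteqP; split=> x /=; rewrite CE VE.
Qed.

(** On the column space of [M], restriction to the rows [e] has the line of [M *m c0] as its kernel,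
    so the rank drops by exactly one. *)
Lemma mxrank_rowsub_line (R : fieldType) m n k (M : 'M[R]_(m, n))
    (e : 'I_k -> 'I_m) (c0 : 'cV[R]_n) j :
  (forall i, (M *m c0) (e i) 0 = 0) -> (M *m c0) j 0 != 0 ->
  (forall c : 'cV[R]_n, (forall i, (M *m c) (e i) 0 = 0) ->
     exists a, M *m c = a *: (M *m c0)) ->
  \rank M = (\rank (rowsub e M)).+1.
Proof.
move=> c0e c0j line; set Me := rowsub e M.
have MeE (c : 'cV[R]_n) i : (Me *m c) i 0 = (M *m c) (e i) 0.
  by rewrite mul_rowsub_mx mxE.
apply/eqP; rewrite eqn_leq; apply/andP; split; last first.
  apply: rank_ltmx; rewrite ltmxE; apply/andP; split.
    by apply/row_subP => i; rewrite row_rowsub row_sub.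
  apply/negP => /submxP[D ME]; case/negP: c0j; rewrite ME -mulmxA.
  have -> : Me *m c0 = 0 by apply/colP => i; rewrite MeE c0e mxE.
  by rewrite mulmx0 mxE.
pose N := col_mx Me (row j M).
(* Row [j] restores the row space: the image under [M] of a column annihilated by [N] is a multiple
   of [M *m c0] that vanishes at [j], hence zero. *)
have MN : (M <= N)%MS.
  rewrite submxE; apply/eqP/matrixP => i l; rewrite mxE [RHS]mxE.
  pose c := col l (cokermx N).
  have : N *m c = 0 by rewrite /c colE mulmxA mulmx_coker mul0mx.
  rewrite mul_col_mx -[RHS]col_mx0 => /eq_col_mx[Mec jc].
  have [i'|a ca] := line c; first by rewrite -MeE Mec mxE.
  have a0 : a = 0.
    move/colP/(_ 0): jc; rewrite -row_mul ca mxE mxE [RHS]mxE => /eqP.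
    by rewrite mulf_eq0 (negbTE c0j) orbF => /eqP.
  move/colP/(_ i): ca; rewrite a0 scale0r mxE [RHS]mxE; apply: etrans.
  by apply: eq_bigr => u _; rewrite !mxE.
apply: leq_trans (mxrankS MN) _; rewrite -addsmxE.
apply: leq_trans (mxrank_adds_leqif _ _).1 _.
by rewrite addnC -[leqRHS]add1n leq_add2r rank_leq_row.
Qed.

(** * Faces as zero sets, and facets of simplicial polytopes *)

Lemma homog_mx_rowsub (R : pzRingType) n m k (p : 'I_m -> 'rV[R]_n)
    (e : 'I_k -> 'I_m) :
  homog_mx (p \o e) = rowsub e (homog_mx p).
Proof. by apply/matrixP => i j; rewrite !mxE. Qed.

Lemma mul_homog_mx (R : pzRingType) n m (p : 'I_m -> 'rV[R]_n)
    (c : 'cV[R]_(1 + n)) i :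
  (homog_mx p *m c) i 0 = dot (homog (p i)) c.
Proof. by rewrite -(rowK (fun i => homog (p i)) i) -row_mul [RHS]mxE. Qed.

(** The pair [a], [b] is encoded by the column with entries [b] and [- a], whose values at the
    points are the slacks [b - dot (p i) a]. *)
Lemma face_supportP (R : realType) n m (p : 'I_m -> 'rV[R]_n) I :
  face_support p I <-> exists2 c : 'cV[R]_(1 + n),
    (forall i, 0 <= (homog_mx p *m c) i 0) &
    I = [set i | (homog_mx p *m c) i 0 = 0].
Proof.
split=> [[a [b [pb ->]]]|[c c0 ->]].
  have E i : (homog_mx p *m col_mx b%:M (- a)) i 0 = b - dot (p i) a.
    rewrite mul_homog_mx dot_homog col_mxKd dotNr.
    congr (_ + _); have -> : 0 = lshift n 0 :> 'I_(1 + n) by exact: val_inj.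
    by rewrite col_mxEu mxE eqxx.
  exists (col_mx b%:M (- a)) => [i|]; first by rewrite E subr_ge0.
  by apply/seteqP; split=> i /=; rewrite E => h; lra.
exists (- dsubmx c), (c 0 0); split=> [i|].
  by have := c0 i; rewrite mul_homog_mx dot_homog dotNr => h; lra.
by apply/seteqP; split=> i /=; rewrite mul_homog_mx dot_homog dotNr => h; lra.
Qed.

Lemma simplex_rank (R : realType) n k (p : 'I_k -> 'rV[R]_n) :
  affinely_independent p -> \rank (homog_mx p) = k.
Proof.
move=> ap; apply/eqP; rewrite -/(row_free _) -kermx_eq0; apply/rowV0P => u.
move=> /sub_kermxP; rewrite mulmx_sum_row.
under eq_bigr do rewrite rowK.
rewrite homog_comb -row_mx0 => /eq_row_mx[/matrixP/(_ 0 0)].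
rewrite !mxE eqxx mulr1n => u0 up; apply/rowP => i; rewrite mxE.
exact: ap.
Qed.

(** In a suitable combination giving [v], only generators maximizing the exposing form carry weight;
    such a generator lies in the exposed face, which is just [v]. *)
Lemma vertex_mem_generators (R : realType) n m (P : set 'rV[R]_n)
    (p : 'I_m -> 'rV[R]_n) v :
  vertices P v -> convex_hull (range p) `<=` P ->
  convex_hull (range p) v -> exists i, p i = v.
Proof.
move=> [a [b [Pb vE]]] pP /convex_hull_imageP[c [c0 _ c1 vc]].
have pb i : dot (p i) a <= b.
  by apply/Pb/pP; apply: sub_gen_smallest; exists i.
have : convex_hull (p @` [set i | dot (p i) a = b]) v.
  rewrite -hull_supporting_section //; split.
    by apply/convex_hull_imageP; exists c; split.
  by have : [set v] v by []; rewrite vE => -[].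
move=> /convex_hull_imageP[c' [c0' cI c1' _]].
have [i ci] : exists i, c' i != 0.
  apply/existsP; apply: contra_eqT c1' => /existsPn c'0.
  rewrite big1 ?(eq_sym 0) ?oner_eq0 // => i _; apply/eqP.
  by have := c'0 i; rewrite negbK.
exists i; suff : [set v] (p i) by [].
rewrite vE; split; last exact: cI.
by apply: pP; apply: sub_gen_smallest; exists i.
Qed.

(* The vectors of the column space of [homog_mx p] are the values at the
   points of the affine functions. A nonnegative one of minimal support spans
   the line of all those vanishing where it does, so it cuts out a facet. *)
Lemma simplicial_support (R : realType) n d m (p : 'I_m -> 'rV[R]_n)
    (P := convex_hull (range p)) :
  injective p -> (forall i, vertices P (p i)) -> has_dim P d.+1 ->
  simplicial P ->
  forall c : 'cV[R]_(1 + n), (forall i, 0 <= (homog_mx p *m c) i 0) ->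
    homog_mx p *m c != 0 ->
    (#|[pred i | ((homog_mx p *m c) i ord0 == 0)%R]| <= d.+1)%N.
Proof.
move=> pinj vp dP sP; set M := homog_mx p.
pose Z (c : 'cV[R]_(1 + n)) := [pred i | (M *m c) i ord0 == 0].
move=> c; have [k] := ubnP (m - #|Z c|); elim: k c => // k IH c.
rewrite ltnS => km c0 cn0; rewrite -/(Z c).
(* Either some nonzero nonnegative vector has more zeros, and induction applies to it, or [c] has
   the largest possible number of zeros. *)
have [[z [z0 zn0 lt]]|/forallNP minc] := pselect (exists z : 'cV[R]_(1 + n),
  [/\ forall i, 0 <= (M *m z) i 0, M *m z != 0 & (#|Z c| < #|Z z|)%N]).
  apply: leq_trans (ltnW lt) _.
  apply: IH => //; apply: leq_trans km; rewrite ltn_sub2l //.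
  by apply: leq_trans lt _; rewrite -[leqRHS](card_ord m) max_card.
have [j cj] : exists j, (M *m c) j 0 != 0.
  apply/existsP; apply: contraNT cn0 => /existsPn h; apply/eqP/colP => i.
  by rewrite [RHS]mxE; apply/eqP; have := h i; rewrite negbK.
have line (z : 'cV[R]_(1 + n)) : {in Z c, forall i, (M *m z) i 0 = 0} ->
    exists a, M *m z = a *: (M *m c).
  (* Subtracting the smallest ratio times [c] from [z] leaves nonnegative values and creates a new
     zero, so by maximality all values vanish. *)
  move=> zZ; pose ratio i := (M *m z) i 0 / (M *m c) i 0.
  have [i ci imin] := @arg_minP _ _ _ j [pred i | i \notin Z c] ratio cj.
  exists (ratio i); apply/eqP; rewrite -subr_eq0; apply/negP => /negP zn0.
  have E l : (M *m (z - ratio i *: c)) l 0 =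
      (M *m z) l 0 - ratio i * (M *m c) l 0.
    by rewrite mulmxBr -scalemxAr !mxE.
  have ZE l : l \in Z c -> (M *m (z - ratio i *: c)) l 0 = 0.
    by move=> lZ; rewrite E zZ // (eqP lZ) mulr0 subr0.
  have iE : (M *m (z - ratio i *: c)) i 0 = 0.
    by rewrite E /ratio mulfVK ?subrr.
  apply: (minc (z - ratio i *: c)); split=> [l||].
  - have [lZ|lZ] := boolP (l \in Z c); first by rewrite ZE.
    rewrite E subr_ge0 -ler_pdivlMr; first exact: imin.
    by rewrite lt0r c0 andbT.
  - by rewrite mulmxBr -scalemxAr.
  - apply: proper_card; apply/properP; split.
      by apply/fintype.subsetP => l lZ; rewrite inE ZE.
    by exists i; rewrite // inE iE.
pose e : 'I_#|Z c| -> 'I_m := enum_val.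
have einj : injective e by exact: enum_val_inj.
have eZ i : (M *m c) (e i) 0 = 0 by apply/eqP; exact: (enum_valP i).
have hullE : convex_hull (p @` [set i | (M *m c) i 0 = 0]) =
    convex_hull (range (p \o e)).
  congr convex_hull; apply/seteqP; split=> x /= [i].
    move=> iZ <-; have iZ' : i \in Z c by rewrite inE iZ.
    by exists (enum_rank_in iZ' i); rewrite //= /e enum_rankK_in.
  by move=> _ <-; exists (e i).
have fsup : face_support p [set i | (M *m c) i 0 = 0].
  by apply/face_supportP; exists c.
have rM := (has_dim_convex_hull p _).1 dP.
have rMe : \rank (homog_mx (p \o e)) = d.+1.
  apply/eqP; rewrite -eqSS -rM homog_mx_rowsub; apply/eqP/esym.
  apply: (mxrank_rowsub_line eZ cj) => z ze; apply: line => i iZ.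
  by have := ze (enum_rank_in iZ i); rewrite /e enum_rankK_in.
have FP : facet P (convex_hull (range (p \o e))).
  split; first by rewrite -hullE; apply/face_hullP; eexists; first exact: fsup.
  by exists d; split=> //; apply/has_dim_convex_hull.
have [k' [p' [ap' FE]]] := sP _ FP.
have k'd : k' = d.
  apply: succn_inj; rewrite -(simplex_rank ap'); apply/has_dim_convex_hull.
  by rewrite -FE; apply/has_dim_convex_hull.
have sub : convex_hull (range (p \o e)) `<=` P.
  by apply: convex_hullS => _ [i _ <-]; exists (e i).
(* Each [p (e i)] is a vertex of [P], hence among the [d.+1] generators [p'] of the simplex; as
   these points are distinct, there are at most [d.+1] of them. *)
have h i : exists l, p' l = p (e i).
  apply: (vertex_mem_generators (vp (e i))); rewrite -FE //.
  by apply: sub_gen_smallest; exists i.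
have [f fE] := choice h.
have finj : injective f.
  by move=> i i' ff; apply/einj/pinj; rewrite -!fE ff.
by have := leq_card f finj; rewrite !card_ord k'd.
Qed.

(** * Lagrange interpolation and barycentric weights *)

Definition nodal_weight (R : fieldType) m (t : 'I_m -> R) i : R :=
  (\prod_(j < m | j != i) (t i - t j))^-1.

Lemma nodal_weight_neq0 (R : fieldType) m (t : 'I_m -> R) i :
  injective t -> nodal_weight t i != 0.
Proof.
move=> tinj; rewrite invr_eq0; apply/prodf_neq0 => j ji.
by rewrite subr_eq0; apply: contra ji => /eqP/tinj ->.
Qed.

(* The functional [f |-> \sum_i w_i f(t_i)] is a divided difference. *)
Lemma divided_difference (R : fieldType) m (t : 'I_m.+1 -> R) :
  injective t ->
  (forall f : {poly R}, (size f <= m.+1)%N ->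
     \sum_i nodal_weight t i * f.[t i] = f`_m) /\
  (forall z : 'I_m.+1 -> R, exists2 f : {poly R}, (size f <= m.+1)%N &
     forall i, f.[t i] = z i).
Proof.
move=> tinj; pose w := nodal_weight t.
(* The Lagrange basis: a monic product scaled by [w i], so that its coefficient of degree [m] is
   [w i]. *)
pose l i := w i *: \prod_(j < m.+1 | j != i) ('X - (t j)%:P).
have szp (i : 'I_m.+1) :
    size (\prod_(j < m.+1 | j != i) ('X - (t j)%:P)) = m.+1.
  by rewrite -big_filter size_prod_XsubC -sum1_size big_filter sum1_card
    cardC1 card_ord.
have szl i : (size (l i) <= m.+1)%N.
  by apply: leq_trans (size_scale_leq _ _) _; rewrite szp.
have lt i j : (l i).[t j] = (i == j)%:R.
  rewrite hornerZ horner_prod; have [<-|ij] := eqVneq i j.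
    under eq_bigr do rewrite hornerXsubC.
    by rewrite mulVf // -invr_eq0; exact: nodal_weight_neq0.
  by rewrite (bigD1 j) 1?eq_sym //= hornerXsubC subrr mul0r mulr0.
have lm i : (l i)`_m = w i.
  have /monicP := monic_prod_XsubC (index_enum _) (fun j => j != i) t.
  by rewrite lead_coefE szp /= coefZ => ->; rewrite mulr1.
pose F (z : 'I_m.+1 -> R) := \sum_i z i *: l i.
have Fz z i : (F z).[t i] = z i.
  rewrite horner_sum (bigD1 i)//= hornerZ lt eqxx mulr1 big1 ?addr0 //.
  by move=> j /negbTE ji; rewrite hornerZ lt ji mulr0.
have szF z : (size (F z) <= m.+1)%N.
  apply: leq_trans (size_sum _ _ _) _; apply/bigmax_leqP => i _.
  exact: leq_trans (size_scale_leq _ _) (szl i).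
split=> [f szf|z]; last by exists (F z).
have -> : f = F (fun i => f.[t i]).
  apply/eqP/negPn/negP; rewrite -subr_eq0 => nz.
  have al : all (root (f - F (fun i => f.[t i]))) (codom t).
    by apply/allP => _ /codomP[i ->]; rewrite rootE hornerD hornerN Fz subrr.
  have un : uniq (codom t) by rewrite map_inj_uniq ?enum_uniq.
  have := max_poly_roots nz al un; rewrite size_codom card_ord ltnNge.
  by rewrite (leq_trans (size_polyD _ _)) // size_polyN geq_max szf szF.
rewrite coef_sum; apply: eq_bigr => i _.
by rewrite Fz coefZ lm mulrC.
Qed.

(* Multiplying by X^k reads off the k-th coefficient from the top. *)
Lemma interpolation_size (R : fieldType) d r (t : 'I_(d + r).+1 -> R)
    (h : {poly R}) :
  injective t -> (size h <= (d + r).+1)%N ->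
  (size h <= d.+1)%N <->
  forall k, (k < r)%N -> \sum_i nodal_weight t i * h.[t i] * t i ^+ k = 0.
Proof.
move=> tinj szh; have [dd _] := divided_difference tinj.
have E k : (k <= d + r)%N -> (size h <= (d + r).+1 - k)%N ->
    \sum_i nodal_weight t i * h.[t i] * t i ^+ k = h`_(d + r - k).
  move=> kd sk; have := dd (h * 'X^k).
  rewrite coefMXn ltnNge kd /= => <-.
    by apply: eq_bigr => i _; rewrite hornerM hornerXn mulrA.
  have [->|h0] := eqVneq h 0; first by rewrite mul0r size_poly0.
  by rewrite size_mulXn //; lia.
split=> [hd k kr|sums].
  have kd : (k <= d + r)%N by lia.
  by rewrite E // ?nth_default //; apply: (leq_trans hd); lia.
(* Each vanishing sum kills the next coefficient from the top, lowering the size bound by one. *)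
have H k : (k <= r)%N -> (size h <= (d + r).+1 - k)%N.
  elim: k => [|k IH] kr; first by rewrite subn0.
  have sk := IH (ltnW kr); have := sums k kr; rewrite E //; last lia.
  move=> hk; rewrite leqNgt; apply/negP => lt.
  have sE : (size h).-1 = (d + r - k)%N by lia.
  have : lead_coef h = 0 by rewrite lead_coefE sE.
  by move/eqP; rewrite lead_coef_eq0 => /eqP h0; move: lt; rewrite h0 size_poly0.
by have := H r (leqnn r); lia.
Qed.

Lemma interpolation_exists (R : fieldType) d r (t : 'I_(d + r).+1 -> R)
    (z : 'I_(d + r).+1 -> R) :
  injective t ->
  (forall k, (k < r)%N -> \sum_i nodal_weight t i * z i * t i ^+ k = 0) ->
  exists2 h : {poly R}, (size h <= d.+1)%N & forall i, h.[t i] = z i.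
Proof.
move=> tinj zs; have [h szh hz] := (divided_difference tinj).2 z.
exists h => //; apply/(interpolation_size tinj szh) => k kr.
by rewrite -[RHS](zs k kr); apply: eq_bigr => i _; rewrite hz.
Qed.

(** * Nonnegative dependencies of vectors in the plane *)

Definition coface_support (R : numDomainType) r m (g : 'I_m -> 'rV[R]_r)
    (J : set 'I_m) : Prop :=
  exists y : 'I_m -> R, [/\ forall i, 0 <= y i, \sum_i y i *: g i = 0
    & J = [set i | y i != 0]].

(** Otherwise take [j] with [u j < 0] and [tau j] maximal: all terms [u i * (tau i - tau j)] are
    nonnegative and sum to zero, so no [u i] is positive and the sum of [u] is negative. *)
Lemma crossing_pair (R : realFieldType) m (u tau : 'I_m -> R) i0 :
  \sum_i u i = 0 -> \sum_i u i * tau i = 0 -> u i0 != 0 ->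
  (forall i j, 0 < u i -> u j < 0 -> tau i != tau j) ->
  exists i j, [/\ 0 < u i, u j < 0 & tau i < tau j].
Proof.
move=> su sut ui0 ntau.
have [j0 uj0] : exists j, u j < 0.
  apply/existsP; apply: contraNT ui0 => /existsPn u0; apply/eqP.
  have := su => /eqP; rewrite psumr_eq0 => [/allP/(_ i0)|i _].
    by rewrite mem_index_enum => /(_ isT) /eqP.
  by rewrite leNgt u0.
have [j uj jmax] := @arg_maxP _ _ _ j0 [pred j | u j < 0] tau uj0.
have [//|/forallNP no] := pselect (exists i j, [/\ 0 < u i, u j < 0 & tau i < tau j]).
have ge0 i : 0 <= u i * (tau i - tau j).
  have [ui|ui|->] := ltgtP (u i) 0; last by rewrite mul0r.
    by apply: mulr_le0; [exact: ltW | rewrite subr_le0; exact: jmax].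
  apply: mulr_ge0; first exact: ltW.
  rewrite subr_ge0 leNgt; apply/negP => lt.
  by apply: (no i); exists j.
have s0 : \sum_i u i * (tau i - tau j) = 0.
  under eq_bigr do rewrite mulrBr.
  by rewrite sumrB sut -mulr_suml su mul0r subr0.
have pos0 i : ~ 0 < u i.
  move=> ui; move/eqP: s0; rewrite psumr_eq0 // => /allP/(_ i).
  rewrite mem_index_enum => /(_ isT); rewrite mulf_eq0 subr_eq0 gt_eqF //=.
  by rewrite (negbTE (ntau i j ui uj)).
have : \sum_i u i < 0.
  rewrite (bigD1 j)//=; apply: le_lt_trans uj; rewrite gerDl sumr_le0 // => i _.
  by rewrite leNgt; apply/negP/pos0.
by rewrite su ltxx.
Qed.

(** The cofaces of the planar vectors with coordinates [rho i] and [rho i * tau i]. *)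
Definition line_coface (R : numDomainType) m (rho tau : 'I_m -> R)
    (J : set 'I_m) : Prop :=
  exists y : 'I_m -> R, [/\ forall i, 0 <= y i, \sum_i y i * rho i = 0,
    \sum_i y i * (rho i * tau i) = 0 & J = [set i | y i != 0]].

(** By Cramer's rule, three planar vectors have a dependency whose coefficients are their two-by-two
    minors up to sign; signs of [rho] alternating along increasing [tau] make all three positive. *)
Lemma circuit_coface (R : realFieldType) m (rho tau : 'I_m -> R)
    (J : set 'I_m) a b c :
  J a -> J b -> J c -> tau a < tau b -> tau b < tau c ->
  rho a * rho b < 0 -> rho b * rho c < 0 ->
  exists y : 'I_m -> R, [/\ forall i, 0 <= y i, \sum_i y i * rho i = 0,
    \sum_i y i * (rho i * tau i) = 0, forall i, y i != 0 -> J i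
    & [/\ 0 < y a, 0 < y b & 0 < y c]].
Proof.
move=> Ja Jb Jc ab bc rab rbc.
have rac : 0 < rho a * rho c.
  have rb : 0 < rho b ^+ 2.
    rewrite exprn_even_gt0 //=; apply: contraTneq rab => ->.
    by rewrite mulr0 ltxx.
  rewrite -(pmulr_lgt0 _ rb).
  have -> : rho a * rho c * rho b ^+ 2 = rho a * rho b * (rho b * rho c) by ring.
  by rewrite nmulr_rgt0.
pose al := (tau c - tau b) * - (rho b * rho c).
pose be := (tau c - tau a) * (rho a * rho c).
pose ga := (tau b - tau a) * - (rho a * rho b).
have al0 : 0 < al by rewrite mulr_gt0 // ?subr_gt0 // oppr_gt0.
have be0 : 0 < be by rewrite mulr_gt0 // subr_gt0 (lt_trans ab).
have ga0 : 0 < ga by rewrite mulr_gt0 // ?subr_gt0 // oppr_gt0.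
pose y i := al * (i == a)%:R + be * (i == b)%:R + ga * (i == c)%:R.
have sy (f : 'I_m -> R) : \sum_i y i * f i = al * f a + be * f b + ga * f c.
  have pick x (k : 'I_m) : \sum_i x * (i == k)%:R * f i = x * f k.
    rewrite (bigD1 k)//= eqxx mulr1 big1 ?addr0 // => i /negbTE ->.
    by rewrite mulr0 mul0r.
  under eq_bigr do rewrite !mulrDl.
  by rewrite !big_split/= !pick.
have ge i : [/\ 0 <= al * (i == a)%:R, 0 <= be * (i == b)%:R
    & 0 <= ga * (i == c)%:R].
  by split; rewrite mulr_ge0 // ltW.
exists y; split.
- by move=> i; have [? ? ?] := ge i; rewrite !addr_ge0.
- by rewrite sy /al /be /ga; ring.
- by rewrite sy /al /be /ga; ring.
- move=> i; rewrite /y; have [->//|_] := eqVneq i a.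
  have [->//|_] := eqVneq i b; have [->//|_] := eqVneq i c.
  by rewrite !mulr0 !addr0 eqxx.
- split; rewrite /y.
  + by have [_ ? ?] := ge a; rewrite eqxx mulr1 -addrA ltr_pwDl // addr_ge0.
  + by have [? _ ?] := ge b; rewrite eqxx mulr1 -addrA addrCA ltr_pwDl // addr_ge0.
  + by have [? ? _] := ge c; rewrite eqxx mulr1 addrC ltr_pwDl // addr_ge0.
Qed.

(* Whether J is a coface only depends on the relative order of the tau's of
   opposite signs, so that the tau's can be perturbed. *)
Lemma line_cofaceP (R : realFieldType) m (rho tau : 'I_m -> R) (J : set 'I_m) :
  (forall i, rho i != 0) ->
  (forall i j, 0 < rho i -> rho j < 0 -> tau i != tau j) ->
  line_coface rho tau J <-> J = set0 \/
    (exists i j, [/\ J i, J j, 0 < rho i, rho j < 0 & tau i < tau j]) /\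
    (exists i j, [/\ J i, J j, 0 < rho i, rho j < 0 & tau j < tau i]).
Proof.
move=> rho0 ntau; split=> [[y [y0 s1 s2 ->]]|].
  have [->|/set0P[i0 /= yi0]] := eqVneq [set i | y i != 0] set0; [by left | right].
  have yp i : 0 < y i * rho i -> y i != 0 /\ 0 < rho i.
    move=> h; have yn : y i != 0 by apply: contraTneq h => ->; rewrite mul0r ltxx.
    by split=> //; move: h; rewrite pmulr_rgt0 // lt0r yn y0.
  have yn i : y i * rho i < 0 -> y i != 0 /\ rho i < 0.
    move=> h; have yn : y i != 0 by apply: contraTneq h => ->; rewrite mul0r ltxx.
    by split=> //; move: h; rewrite pmulr_rlt0 // lt0r yn y0.
  have u0 : y i0 * rho i0 != 0 by rewrite mulf_neq0.
  have s2' : \sum_i y i * rho i * tau i = 0.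
    by rewrite -[RHS]s2; apply: eq_bigr => i _; rewrite mulrA.
  have nu i j : 0 < y i * rho i -> y j * rho j < 0 -> tau i != tau j.
    by move=> /yp[_ ri] /yn[_ rj]; exact: ntau.
  split.
    have [i [j [/yp[? ?] /yn[? ?] ?]]] := crossing_pair s1 s2' u0 nu.
    by exists i, j.
  have s2N : \sum_i y i * rho i * - tau i = 0.
    by under eq_bigr do rewrite mulrN; rewrite sumrN s2' oppr0.
  have [|i [j [/yp[? ?] /yn[? ?] ?]]] := crossing_pair s1 s2N u0.
    by move=> i j ri rj; rewrite eqr_opp nu.
  by exists i, j; split=> //; rewrite -ltrN2.
move=> [->|[[i [j [Ji Jj ri rj ij]]] [k [l [Jk Jl rk rl lk]]]]].
  exists (fun=> 0); split=> //; [by rewrite big1 // => ? _; rewrite mul0r | |].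
    by rewrite big1 // => ? _; rewrite mul0r.
  by apply/seteqP; split=> x //=; rewrite eqxx.
pose covered e := exists y : 'I_m -> R, [/\ forall i, 0 <= y i,
    \sum_i y i * rho i = 0, \sum_i y i * (rho i * tau i) = 0,
    forall i, y i != 0 -> J i & 0 < y e].
have circ a b c : J a -> J b -> J c -> tau a < tau b -> tau b < tau c ->
    rho a * rho b < 0 -> rho b * rho c < 0 ->
    [/\ covered a, covered b & covered c].
  move=> Ja Jb Jc ab bc rab rbc.
  have [y [? ? ? ? [? ? ?]]] := circuit_coface Ja Jb Jc ab bc rab rbc.
  by split; exists y.
have pn a b : 0 < rho a -> rho b < 0 -> rho a * rho b < 0.
  by move=> ra; rewrite pmulr_rlt0.
have np a b : rho a < 0 -> 0 < rho b -> rho a * rho b < 0.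
  by move=> ra; rewrite nmulr_rlt0.
have cmp a b : 0 < rho a -> rho b < 0 -> tau a < tau b \/ tau b < tau a.
  by move=> ra rb; apply/orP; rewrite -neq_lt ntau.
(* Every [e] in [J] forms, with two of [i], [j], [k], [l], a triple of increasing [tau] and
   alternating signs; the cases locate [e] relative to them. *)
have key e : J e -> covered e.
  have [re|re|/eqP] := ltgtP (rho e) 0; last by rewrite (negbTE (rho0 e)).
  - move=> Je; have [ke|ek] := cmp k e rk re.
      by have [] := circ l k e Jl Jk Je lk ke (np _ _ rl rk) (pn _ _ rk re).
    have [ie|ei] := cmp i e ri re.
      by have [] := circ i e k Ji Je Jk ie ek (pn _ _ ri re) (np _ _ re rk).
    by have [] := circ e i j Je Ji Jj ei ij (np _ _ re ri) (pn _ _ ri rj).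
  - move=> Je; have [ej|je] := cmp e j re rj; last first.
      by have [] := circ i j e Ji Jj Je ij je (pn _ _ ri rj) (np _ _ rj re).
    have [el|le] := cmp e l re rl.
      by have [] := circ e l k Je Jl Jk el lk (pn _ _ re rl) (np _ _ rl rk).
    by have [] := circ l e j Jl Je Jj le ej (np _ _ rl re) (pn _ _ re rj).
have key' e : exists y : 'I_m -> R, [/\ forall i, 0 <= y i,
    \sum_i y i * rho i = 0, \sum_i y i * (rho i * tau i) = 0,
    forall i, y i != 0 -> J i & J e -> 0 < y e].
  have [/key[y [? ? ? ? ?]]|nJe] := pselect (J e); first by exists y.
  exists (fun=> 0); split=> // [||x]; last by rewrite eqxx.
    by rewrite big1 // => ? _; rewrite mul0r.
  by rewrite big1 // => ? _; rewrite mul0r.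
have [Y YP] := choice key'.
have Y0 e x : 0 <= Y e x by have [] := YP e.
(* Each [Y e] is supported in [J] and positive at [e] if [e] is in [J], so the sum has support
   exactly [J]. *)
exists (fun x => \sum_e Y e x); split.
- by move=> x; apply: sumr_ge0.
- under eq_bigr do rewrite mulr_suml.
  by rewrite exchange_big big1 // => e _; have [_ + _ _ _] := YP e.
- under eq_bigr do rewrite mulr_suml.
  by rewrite exchange_big big1 // => e _; have [_ _ + _ _] := YP e.
apply/seteqP; split=> x /=.
  move=> Jx; rewrite gt_eqF // (bigD1 x)//= ltr_pwDl ?sumr_ge0 //.
  by have [_ _ _ _ /(_ Jx)] := YP x.
apply: contra_neqP => nJx; apply: big1 => e _; apply/eqP/negPn/negP => n0.
by apply: nJx; have [_ _ _ + _] := YP e; apply.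
Qed.

(** Rank by [tau], with ties broken by the index, which is the remainder modulo [m] and is
    outweighed by any difference in rank. *)
Lemma strict_refinement (R : realFieldType) m (tau : 'I_m -> R) :
  exists2 t : 'I_m -> R, injective t & forall i j, tau i < tau j -> t i < t j.
Proof.
pose rk (i : 'I_m) := #|[pred j | tau j < tau i]|.
exists (fun i => (rk i * m + i)%N%:R) => [i j /eqP|i j ij].
  rewrite eqr_nat => /eqP /(congr1 (modn^~ m)).
  by rewrite !modnMDl !modn_small // => /val_inj.
rewrite ltr_nat.
have : (rk i < rk j)%N.
  apply: proper_card; apply/properP; split.
    by apply/fintype.subsetP => l; rewrite !inE => /lt_trans; apply.
  by exists i; rewrite !inE ?ltxx.
by have := ltn_ord i; nia.
Qed.

(** Refining the order only separates ties, and [tau] has none between opposite signs, so the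
    criterion of [line_cofaceP] is preserved. *)
Lemma perturb_line_coface (R : realFieldType) m (rho tau : 'I_m -> R) :
  (forall i, rho i != 0) ->
  (forall i j, 0 < rho i -> rho j < 0 -> tau i != tau j) ->
  exists2 t : 'I_m -> R, injective t &
    forall J, line_coface rho tau J <-> line_coface rho t J.
Proof.
move=> rho0 ntau; have [t tinj tlt] := strict_refinement tau.
exists t => // J.
have nt i j : 0 < rho i -> rho j < 0 -> t i != t j.
  move=> ri rj; apply/eqP => /tinj ij; move: ri; rewrite ij => /(lt_trans rj).
  by rewrite ltxx.
have lt i j : 0 < rho i -> rho j < 0 -> (tau i < tau j) = (t i < t j) /\
    (tau j < tau i) = (t j < t i).
  move=> ri rj; have := ntau i j ri rj; have := tlt i j; have := tlt j i.
  case: (ltgtP (tau i) (tau j)) => // h h1 h2 _.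
    by have := h2 isT => h3; rewrite h3 (lt_gtF h3).
  by have := h1 isT => h3; rewrite h3 (lt_gtF h3).
rewrite (line_cofaceP J rho0 ntau) (line_cofaceP J rho0 nt).
split=> -[->|[[i [j [? ? ri rj ij]]] [k [l [? ? rk rl kl]]]]]; [by left| |by left|].
  right; split; [exists i, j | exists k, l]; split=> //.
    by rewrite -(lt i j ri rj).1.
  by rewrite -(lt k l rk rl).2.
right; split; [exists i, j | exists k, l]; split=> //.
  by rewrite (lt i j ri rj).1.
by rewrite (lt k l rk rl).2.
Qed.

(** * Moving Gale duals onto the moment curve *)

Lemma coface_support_kernel (R : numDomainType) r r' m (g : 'I_m -> 'rV[R]_r)
    (g' : 'I_m -> 'rV[R]_r') J :
  (forall y : 'I_m -> R,
     \sum_i y i *: g i = 0 <-> \sum_i y i *: g' i = 0) ->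
  coface_support g J <-> coface_support g' J.
Proof. by move=> gg'; split=> -[y [y0 /gg' yg JE]]; exists y. Qed.

Lemma rV2_comb_eq0 (R : pzRingType) m (y : 'I_m -> R) (g : 'I_m -> 'rV[R]_2) :
  \sum_i y i *: g i = 0 <->
  \sum_i y i * g i 0 0 = 0 /\ \sum_i y i * g i 0 1 = 0.
Proof.
have E k : (\sum_i y i *: g i) 0 k = \sum_i y i * g i 0 k.
  by rewrite summxE; apply: eq_bigr => i _; rewrite mxE.
split=> [s0|[s0 s1]]; first by rewrite -!E s0 !mxE.
apply/rowP => k; rewrite E [RHS]mxE.
by case: k => [[|[|//]] lt]; [rewrite -[RHS]s0 | rewrite -[RHS]s1];
  apply: eq_bigr => i _; congr (_ * g i _ _); apply: val_inj.
Qed.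

Lemma rV2_nonvertical (R : realFieldType) m (g : 'I_m -> 'rV[R]_2) :
  (forall i, g i != 0) -> exists s, forall i, g i 0 0 + s * g i 0 1 != 0.
Proof.
move=> g0; pose b i := `|g i 0 0 / g i 0 1|.
(* This value exceeds the absolute value of every ratio of coordinates. *)
exists (1 + \sum_i b i) => i; apply/eqP => e.
have [z|nz] := eqVneq (g i 0 1) 0.
  case/negP: (g0 i); apply/eqP/rowP => k; rewrite [RHS]mxE.
  move: e; rewrite z mulr0 addr0 => e.
  by case: k => [[|[|//]] lt]; [rewrite -e | rewrite -z]; congr (g i _ _);
    apply: val_inj.
have : 1 + \sum_i b i = - (g i 0 0 / g i 0 1).
  by apply: (mulIf nz); rewrite mulNr mulfVK //; lra.
have := ler_norm (- (g i 0 0 / g i 0 1)); rewrite normrN -/(b i) => h1 h2.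
have : b i <= \sum_i b i.
  by rewrite (bigD1 i)//= lerDl sumr_ge0 // => j _; exact: normr_ge0.
by lra.
Qed.

Definition moment_row (R : pzRingType) r m (s t : 'I_m -> R) (i : 'I_m) :
  'rV[R]_r := \row_(k < r) (s i * t i ^+ k).

(** Gale dual form of simpliciality: a proper face with at most [d] of [d + 1 + r] points has a
    complement of more than [r]. *)
Definition large_cofaces (R : numDomainType) r m (g : 'I_m -> 'rV[R]_r) : Prop :=
  forall y : 'I_m -> R, (forall i, 0 <= y i) -> \sum_i y i *: g i = 0 ->
    (exists i, y i != 0) -> (r < #|[pred i | y i != 0%R]|)%N.

Lemma large_cofaces_neq0 (R : numDomainType) r m (g : 'I_m -> 'rV[R]_r) i :
  (0 < r)%N -> large_cofaces g -> g i != 0.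
Proof.
move=> r0 big; apply/eqP => gi; pose y (j : 'I_m) : R := (j == i)%:R.
have ys : \sum_j y j *: g j = 0.
  rewrite /y (bigD1 i)//= eqxx gi scaler0 add0r big1 // => j /negbTE ->.
  by rewrite scale0r.
have yi : exists j, y j != 0 by exists i; rewrite /y eqxx oner_eq0.
have := big y (fun j => ler0n _ _) ys yi.
rewrite (@fintype.eq_card1 _ i) => [|j]; first by rewrite ltnS leqNgt r0.
by rewrite !inE /y; have [_|_] := eqVneq j i; rewrite ?oner_eq0 ?eqxx.
Qed.

Lemma planar_on_moment_curve (R : realFieldType) m (g : 'I_m -> 'rV[R]_2) :
  large_cofaces g ->
  exists t s : 'I_m -> R, [/\ injective t, forall i, s i != 0
    & forall J, coface_support g J <-> coface_support (moment_row 2 s t) J].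
Proof.
move=> big.
have g0 i : g i != 0 by exact: large_cofaces_neq0.
have [a a0] := rV2_nonvertical g0.
(* A shear turns [g i] into [rho i] times the vector [(1, tau i)] and keeps all dependencies. *)
pose rho i := g i 0 0 + a * g i 0 1.
pose tau i := g i 0 1 / rho i.
have ker (y : 'I_m -> R) : \sum_i y i *: g i = 0 <->
    \sum_i y i * rho i = 0 /\ \sum_i y i * (rho i * tau i) = 0.
  rewrite rV2_comb_eq0.
  have -> : \sum_i y i * rho i =
      \sum_i y i * g i 0 0 + a * \sum_i y i * g i 0 1.
    rewrite mulr_sumr -big_split/=; apply: eq_bigr => i _.
    by rewrite /rho; ring.
  have -> : \sum_i y i * (rho i * tau i) = \sum_i y i * g i 0 1.
    by apply: eq_bigr => i _; congr (_ * _); rewrite mulrC divfK ?a0.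
  split=> [[-> ->]|[+ s1]]; first by rewrite mulr0 addr0.
  by rewrite s1 mulr0 addr0.
have ntau i j : 0 < rho i -> rho j < 0 -> tau i != tau j.
  move=> ri rj; apply/eqP => tij.
  have ij : (j == i) = false by apply/eqP => ji; move: ri; rewrite -ji; lra.
  have ij' : (i == j) = false by rewrite eq_sym.
  (* Equal [tau] at opposite signs makes the two vectors negative multiples of each other, giving a
     dependency with too small a support. *)
  pose y k := (k == i)%:R * - rho j + (k == j)%:R * rho i.
  have sy (f : 'I_m -> R) : \sum_k y k * f k = - rho j * f i + rho i * f j.
    rewrite (bigD1 i)//= (bigD1 j) ?ij //= /y !eqxx ij ij' /=.
    rewrite big1 => [|k /andP[/negbTE -> /negbTE ->]].
      by rewrite mul1r mul0r !addr0 mul0r add0r mul1r.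
    by rewrite !mul0r addr0 mul0r.
  have y0 k : 0 <= y k by rewrite /y addr_ge0 // mulr_ge0 ?ler0n //; lra.
  have ys : \sum_k y k *: g k = 0 by apply/ker; rewrite !sy tij; split; ring.
  have yi : exists k, y k != 0.
    exists i; rewrite /y eqxx ij' mul1r mul0r addr0 oppr_eq0.
    by apply/eqP => rj0; move: rj; rewrite rj0 ltxx.
  have := big y y0 ys yi; rewrite ltnNge => /negP; apply.
  have le : (#|[pred k | y k != 0%R]| <= #|pred2 i j|)%N.
    apply/subset_leq_card/fintype.subsetP => k; rewrite !inE /y.
    have [//|_] := eqVneq k i; have [//|_] := eqVneq k j.
    by rewrite !mul0r addr0 eqxx.
  by apply: leq_trans le _; rewrite card2; case: (_ != _).
have [t tinj tJ] := perturb_line_coface a0 ntau.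
exists t, rho; split=> // J.
apply: iff_trans (iff_trans _ (tJ J)) _.
  split=> [[y [y0 /ker[s0 s1] ->]]|[y [y0 s0 s1 ->]]]; exists y; split=> //.
  exact/ker.
have ker' (y : 'I_m -> R) : \sum_i y i *: moment_row 2 rho t i = 0 <->
    \sum_i y i * rho i = 0 /\ \sum_i y i * (rho i * t i) = 0.
  rewrite rV2_comb_eq0.
  by under eq_bigr do rewrite mxE expr0 mulr1;
    under [in X in _ /\ X]eq_bigr do rewrite mxE expr1.
split=> [[y [y0 s0 s1 ->]]|[y [y0 /ker'[s0 s1] ->]]]; exists y; split=> //.
exact/ker'.
Qed.

(** For [r = 0] every vector is a dependency, and for [r = 1] only the scalars [s] matter, so any
    distinct parameters serve. *)
Lemma dual_on_moment_curve (R : realFieldType) r m (g : 'I_m -> 'rV[R]_r) :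
  (r <= 2)%N ->
  large_cofaces g ->
  exists t s : 'I_m -> R, [/\ injective t, forall i, s i != 0
    & forall J, coface_support g J <-> coface_support (moment_row r s t) J].
Proof.
have inj : injective (fun i : 'I_m => i%:R : R).
  by move=> i j /eqP; rewrite eqr_nat => /eqP/val_inj.
case: r g => [|[|[|//]]] g _ big; last exact: planar_on_moment_curve.
  exists (fun i => i%:R), (fun=> 1); split=> // J.
  by apply: coface_support_kernel => y; rewrite !thinmx0.
exists (fun i => i%:R), (fun i => g i 0 0); split=> // [i|J].
  apply: contra (large_cofaces_neq0 i (ltn0Sn 0) big) => /eqP gi.
  by apply/eqP/rowP => k; rewrite ord1 gi mxE.
apply: coface_support_kernel => y.
have -> // : moment_row 1 (fun i => g i 0 0) (fun i => i%:R) = g.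
by apply: funext => i; apply/rowP => k; rewrite ord1 mxE expr0 mulr1.
Qed.

(** * Gale duality and Veronese realizations *)

(** The cokernel of the transpose detects the column space of [M]; a column base trims it to [r]
    columns, and its rows are the dual vectors. *)
Lemma gale_dual (R : fieldType) m n r (M : 'M[R]_(m, n)) :
  (\rank M + r)%N = m ->
  exists g : 'I_m -> 'rV[R]_r, forall y : 'I_m -> R,
    \sum_i y i *: g i = 0 <-> exists c : 'cV[R]_n, forall i, y i = (M *m c) i 0.
Proof.
move=> rk; pose C := cokermx M^T.
have -> : r = \rank C by rewrite mxrank_coker mxrank_tr; lia.
exists (fun i => row i (col_base C)) => y.
have -> : \sum_i y i *: row i (col_base C) = \row_i y i *m col_base C.
  by rewrite mulmx_sum_row; apply: eq_bigr => i _; rewrite mxE.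
have -> : \row_i y i *m col_base C = 0 <-> (\row_i y i <= M^T)%MS.
  rewrite submxE -/C -[in X in _ <-> X](mulmx_base C) mulmxA.
  rewrite mulmx_free_eq0 ?row_base_free //.
  by split=> [->|/eqP].
split=> [/submxP[D DE]|[c cE]].
  exists D^T => i; move/rowP/(_ i): DE; rewrite mxE => ->.
  by rewrite -[M in RHS]trmxK -trmx_mul [RHS]mxE.
apply/submxP; exists c^T; rewrite -trmx_mul; apply/rowP => i.
by rewrite !mxE cE mxE.
Qed.

Lemma face_coface_support (R : realType) n r m (p : 'I_m -> 'rV[R]_n)
    (g : 'I_m -> 'rV[R]_r) I :
  (forall y : 'I_m -> R, \sum_i y i *: g i = 0 <->
     exists c : 'cV[R]_(1 + n), forall i, y i = (homog_mx p *m c) i 0) ->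
  face_support p I <-> coface_support g (~` I).
Proof.
move=> gp; rewrite face_supportP; split=> [[c c0 ->]|[y [y0 /gp[c yc] IE]]].
  exists (fun i => (homog_mx p *m c) i 0); split=> //.
    by apply/gp; exists c.
  by apply/seteqP; split=> i /= /eqP.
exists c => [i|]; first by rewrite -yc.
rewrite -[I]setCK IE; apply/seteqP; split=> i /=; rewrite -yc.
  by move/negP; rewrite negbK => /eqP.
by move=> ->; rewrite eqxx.
Qed.

Lemma nu_horner (R : realType) d (x : R) (a : 'cV[R]_d.+1) :
  dot (nu d x) a = (rVpoly a^T).[x].
Proof.
rewrite (horner_coef_wide x (size_poly _ _)) mxE; apply: eq_bigr => i _.
by rewrite mxE (coef_rVpoly_ord a^T) mxE mulrC.
Qed.

Lemma qxi_horner (R : realType) d (xi : 'rV[R]_d.+1) (x : R) :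
  qxi xi x = (rVpoly xi).[x].
Proof.
rewrite (horner_coef_wide x (size_poly _ _)); apply: eq_bigr => i _.
by rewrite (coef_rVpoly_ord xi).
Qed.

Lemma moment_row_comb_eq0 (R : comPzRingType) r m (s t y : 'I_m -> R) :
  \sum_i y i *: moment_row r s t i = 0 <->
  forall k, (k < r)%N -> \sum_i y i * s i * t i ^+ k = 0.
Proof.
have E k : (\sum_i y i *: moment_row r s t i) 0 k = \sum_i y i * s i * t i ^+ k.
  by rewrite summxE; apply: eq_bigr => i _; rewrite !mxE mulrA.
split=> [s0 k kr|s0]; first by have := E (Ordinal kr); rewrite s0 mxE => <-.
by apply/rowP => k; rewrite E (s0 k (ltn_ord k)) mxE.
Qed.

(* Values h(t_i) of a polynomial of degree at most d correspond to the
   dependencies y_i = w_i h(t_i) / s_i of the Gale dual configuration. *)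
Lemma veronese_realization (R : realType) d r (s t : 'I_(d + r).+1 -> R) :
  injective t -> (forall i, s i != 0) ->
  coface_support (moment_row r s t) setT ->
  exists q : 'I_(d + r).+1 -> 'rV[R]_d.+1,
    veronese_polytope (convex_hull (range q)) /\
    forall I, face_support q I <-> coface_support (moment_row r s t) (~` I).
Proof.
move=> tinj s0 [Y [Y0 Ys YT]].
have Yn i : Y i != 0 by have : [set: 'I_(d + r).+1] i by []; rewrite YT.
pose w := nodal_weight t.
have w0 i : w i != 0 by exact: nodal_weight_neq0.
have polyP (y : 'I_(d + r).+1 -> R) :
    \sum_i y i *: moment_row r s t i = 0 <->
    exists2 h : {poly R}, (size h <= d.+1)%N &
      forall i, h.[t i] = y i * s i / w i.
  rewrite moment_row_comb_eq0.
  have E k (h : 'I_(d + r).+1 -> R) : (forall i, h i = y i * s i / w i) ->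
      \sum_i w i * h i * t i ^+ k = \sum_i y i * s i * t i ^+ k.
    by move=> hE; apply: eq_bigr => i _; rewrite hE mulrCA divff ?mulr1.
  split=> [ys|[h szh hE] k kr].
    by apply: interpolation_exists => // k kr; rewrite E // ys.
  rewrite -(E k (fun i => h.[t i])) //.
  by apply: (interpolation_size tinj _).1 => //; apply: (leq_trans szh); lia.
(* The strictly positive dependency yields the denominator [q], which vanishes at no node. *)
have [q szq qE] := (polyP Y).1 Ys.
have qn i : q.[t i] != 0.
  by rewrite qE !mulf_eq0 invr_eq0 !negb_or Yn s0 w0.
pose xi : 'rV[R]_d.+1 := poly_rV q.
have xiE x : qxi xi x = q.[x] by rewrite qxi_horner poly_rV_K.
exists (fun i => (q.[t i])^-1 *: nu d (t i)); split.
  exists [fset t i | i in 'I_(d + r).+1]%fset, xi; split.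
  - by rewrite card_imfset //= -cardE card_ord; lia.
  - by apply/eqP => xi0; have := qn 0; rewrite -xiE xi0 qxi_horner linear0 horner0 eqxx.
  - by move=> _ /imfsetP[i _ ->]; rewrite xiE.
  congr convex_hull; apply/seteqP; split=> x /= [].
    by move=> i _ <-; exists (t i); rewrite ?xiE //; apply/imfsetP; exists i.
  by move=> _ /imfsetP[i _ ->] <-; exists i; rewrite ?xiE.
have dq i (a : 'cV[R]_d.+1) :
    dot ((q.[t i])^-1 *: nu d (t i)) a = (rVpoly a^T).[t i] / q.[t i].
  by rewrite dotZl nu_horner mulrC.
move=> I; split=> [[a [b [qb ->]]]|[y [y0 /polyP[h szh hE] IE]]].
  have hE i : (b *: q - rVpoly a^T).[t i] =
      (b - (rVpoly a^T).[t i] / q.[t i]) * q.[t i].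
    by rewrite hornerD hornerN hornerZ mulrBl divfK.
  (* The polynomial [b *: q - rVpoly a^T] takes at [t i] the slack times [q.[t i]], so its
     dependency is the slack times [Y i]. *)
  exists (fun i => Y i * (b - (rVpoly a^T).[t i] / q.[t i])); split.
  - by move=> i; rewrite mulr_ge0 // subr_ge0 -dq.
  - apply/polyP; exists (b *: q - rVpoly a^T).
      rewrite (leq_trans (size_polyD _ _)) // geq_max size_polyN size_poly andbT.
      exact: leq_trans (size_scale_leq _ _) szq.
    by move=> i; rewrite hE qE; ring.
  apply/seteqP; split=> i /=; rewrite dq mulf_eq0 (negbTE (Yn i)) subr_eq0 eq_sym.
    by move/eqP.
  by move=> /eqP.
(* Conversely, the form given by [- h] takes the values [- (y i / Y i)], so its bound zero is
   attained exactly where [y] vanishes. *)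
have yE i : (rVpoly (poly_rV (- h) : 'rV[R]_d.+1)).[t i] / q.[t i] =
    - (y i / Y i).
  rewrite poly_rV_K ?size_polyN // hornerN hE qE.
  by field; rewrite s0 w0 Yn.
exists (poly_rV (- h))^T, 0; split=> [i|].
  by rewrite dq trmxK yE oppr_le0 divr_ge0.
rewrite -[I]setCK IE; apply/seteqP; split=> i /=; rewrite dq trmxK yE.
  by move/negP; rewrite negbK => /eqP ->; rewrite mul0r oppr0.
move/eqP; rewrite oppr_eq0 mulf_eq0 invr_eq0 (negbTE (Yn i)) orbF => ->.
by [].
Qed.

(** * From the vertex count to a Veronese polytope *)

Unset Implicit Arguments.

Theorem theorem3p15 (R : realType) (d n : nat) (P : set 'rV[R]_n)
    (hd : (1 <= d)%N)
    (hP : polytope P) (hdim : has_dim P d) (hsimp : simplicial P)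
    (hvert : vertices P #= `I_(d + 1) \/ vertices P #= `I_(d + 2) \/
             vertices P #= `I_(d + 3)) :
  exists Q : set 'rV[R]_d.+1,
    veronese_polytope Q /\ combinatorially_equivalent P Q.
Proof.
have [m [p [pinj PE vp]]] := polytope_vertices hP; subst P.
have vE : vertices (convex_hull (range p)) #= `I_m.
  have -> : vertices (convex_hull (range p)) = range p.
    apply/seteqP; split=> [v vv|_ [i _ <-] //].
    have [i <-] : exists i, p i = v; last by exists i.
    apply: (vertex_mem_generators vv) => //.
    by case: vv => a [b [_ vE]]; have : [set v] v by []; rewrite vE => -[].
  rewrite (card_eql (inj_card_eq _)); last by move=> i j _ _; exact: pinj.
  by rewrite card_eq_sym card_II.
have [r r2 mE] : exists2 r, (r <= 2)%N & m = (d + r).+1.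
  have eqm k : vertices (convex_hull (range p)) #= `I_k -> m = k.
    by rewrite (card_eql vE) => /card_eq_II.
  by case: hvert => [/eqm ->|[/eqm ->|/eqm ->]];
    [exists 0%N | exists 1%N | exists 2%N] => //; lia.
subst m; have rM := (has_dim_convex_hull p d).1 hdim.
have [g gP] := @gale_dual R _ _ r (homog_mx p) ltac:(rewrite rM; lia).
have fcP I := face_coface_support I gP.
have [|t [s [tinj s0 gE]]] := dual_on_moment_curve r2 (g := g).
  move=> y y0 /gP[c yc] [i yi].
  have c0 j : 0 <= (homog_mx p *m c) j 0 by rewrite -yc.
  have cn0 : homog_mx p *m c != 0.
    by apply: contra_neq yi => c00; rewrite yc c00 mxE.
  have hdim' : has_dim (convex_hull (range p)) d.-1.+1 by rewrite prednK.
  have := simplicial_support pinj vp hdim' hsimp c0 cn0; rewrite prednK //.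
  set Z := [pred j | _] => Zd.
  (* At most [d] zeros among [(d + r).+1] indices leave more than [r] nonzero entries. *)
  have := cardC Z; rewrite card_ord.
  have -> : #|[predC Z]| = #|[pred j | y j != 0]|.
    by apply: eq_card => j; rewrite !inE yc.
  by move=> cE; rewrite -(leq_add2l d) addnS -[leqLHS]cE leq_add2r.
(* The empty set is a face, cut out by the zero form and the bound one; its coface is the strictly
   positive dependency that supplies the denominators. *)
have sT : coface_support (moment_row r s t) setT.
  rewrite -gE -[setT]setC0 -fcP; exists 0, 1; split=> [i|].
    by rewrite mulmx0 mxE.
  by apply/seteqP; split=> i //=; rewrite mulmx0 mxE => /eqP; rewrite eq_sym oner_eq0.
have [q [vq qE]] := veronese_realization tinj s0 sT.
exists (convex_hull (range q)); split=> //.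
by apply: face_support_equivalent => I; rewrite fcP qE gE.
Qed.
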